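(* Every locally isometric graph with maximum degree $\Delta \le 6$ and order $n \ge \Delta +1$ is weakly pancyclic.
   Context: All graphs are finite and simple; the order of a graph is its number of vertices. For a vertex $v$, $\langle N(v)\rangle$ is the subgraph induced by the open neighbourhood $N(v)$. A graph $G$ is locally isometric if for every vertex $v$ the graph $\langle N(v)\rangle$ has diameter at most $2$, i.e. any two vertices of $\langle N(v)\rangle$ are at distance at most $2$ in $\langle N(v)\rangle$ (in particular $\langle N(v)\rangle$ is connected). $G$ itself is not assumed connected. A graph $G$ is weakly pancyclic if it has a cycle of every length $k$ with $g(G)\le k\le c(G)$, where $g(G)$ (girth) and $c(G)$ (circumference) are the lengths of a shortest and a longest cycle of $G$; a graph without cycles satisfies this vacuously. *)

(* Defs.v *)
(* A finite simple graph is a symmetric irreflexive relation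
   e : rel T on a vertex type T : finType. *)
From mathcomp Require Import all_boot.

Set Implicit Arguments.
Unset Strict Implicit.
Unset Printing Implicit Defensive.

Definition nbhd (T : finType) (e : rel T) (v : T) : {set T} :=
  [set w | e v w].

Definition max_degree (T : finType) (e : rel T) : nat :=
  \max_(v : T) #|nbhd e v|.

Definition induced (T : finType) (e : rel T) (A : {set T}) :
  rel {x : T | x \in A} := relpre val e.

Arguments induced {T} e A _ _.

(* Distance at most k: some walk from u to v has at most k edges; false for
   every k when u and v lie in different components. *)
Definition dist_le (T : finType) (e : rel T) (k : nat) (u v : T) : Prop :=
  exists p : seq T, [/\ path e u p, last u p = v & size p <= k].

Definition diam_le (T : finType) (e : rel T) (k : nat) : Prop :=
  forall u v : T, dist_le e k u v.

Definition locally_isometric (T : finType) (e : rel T) : Prop :=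
  forall v : T, diam_le (induced e (nbhd e v)) 2.

(* The bound 2 < k is needed: a single edge is a ucycle of size 2, and the
   empty sequence one of size 0. *)
Definition has_cycle (T : finType) (e : rel T) (k : nat) : bool :=
  (2 < k) && [exists p : k.-tuple T, ucycleb e p].

(* Cycle lengths are at most #|T|.  In an acyclic graph the girth is the
   default value #|T|.+1 and the circumference is 0, so the range
   girth e <= k <= circumference e is then empty. *)
Definition girth (T : finType) (e : rel T) : nat :=
  \big[minn/#|T|.+1]_(k < #|T|.+1 | has_cycle e k) k.

Definition circumference (T : finType) (e : rel T) : nat :=
  \max_(k < #|T|.+1 | has_cycle e k) k.

Definition weakly_pancyclic (T : finType) (e : rel T) : Prop :=
  forall k : nat, girth e <= k <= circumference e -> has_cycle e k.

(* Main.v *)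
(* If the graph has a cycle it has a triangle, so it suffices to exclude a gap
   in the lengths of the cycles of one component: cycles c and d with
   |c| + 1 < |d|, but none of length |c| + 1 or |d| - 1.  A vertex off c cannot
   be inserted into c, which forbids many edges; as neighbourhoods have diameter
   2 and at most 6 vertices, this forces that a vertex x off c adjacent to c has
   N(x) inside c, and that if |N(x)| > 2 then c alternates between N(x) and its
   complement.
   Since d cannot be shortened by one vertex, consecutive neighbours on d of any
   x in d are nonadjacent, so either d lies in c, or some x in d is off c
   with |N(x)| > 2.  In the latter case the vertices of the component outside
   N(x) are independent, hence |d| <= 2 |N(x)| <= |c|. *)
Require Import Defs.
From mathcomp Require Import all_boot.
Set Implicit Arguments.
Unset Strict Implicit.
Unset Printing Implicit Defensive.

(* [C] is the vertex set of a cycle with successor [n] and predecessor [p].  The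
   numbered fields forbid the edges that would allow to reroute the cycle
   through one or two vertices off [C] into a cycle with one more vertex. *)
Record rigid (T : finType) (e : rel T) (C : pred T) (n p : T -> T) : Prop :=
  Rigid {
    rigid_nK : cancel n p;
    rigid_pK : cancel p n;
    rigid_n : forall u, C u -> C (n u) /\ e u (n u);
    rigid_p : forall u, C u -> C (p u) /\ e u (p u);
    rigid_np : forall u, C u -> n u <> p u;
    rigid1n : forall x u, C x = false -> C u -> e x u -> e x (n u) = false;
    rigid1p : forall x u, C x = false -> C u -> e x u -> e x (p u) = false;
    rigid2n : forall x u w, C x = false -> C u -> C w -> u <> w ->
      e x u -> e x w -> e (n u) (n w) = false;
    rigid2p : forall x u w, C x = false -> C u -> C w -> u <> w ->
      e x u -> e x w -> e (p u) (p w) = false;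
    rigid3n : forall x u w, C x = false -> C u -> C w -> u <> w ->
      e x u -> e x w -> e w (n u) -> e (n w) (p w) = false;
    rigid3p : forall x u w, C x = false -> C u -> C w -> u <> w ->
      e x u -> e x w -> e w (p u) -> e (n w) (p w) = false;
    rigid_ind : forall (P : pred T) u w, C u -> C w -> P u ->
      (forall v, P v -> P (n v) /\ P (p v)) -> P w;
    rigid4n : forall x y u, C x = false -> C y = false -> C u ->
      e x y -> e x u -> e y (n (n u)) -> False;
    rigid4p : forall x y u, C x = false -> C y = false -> C u ->
      e x y -> e x u -> e y (p (p u)) -> False
  }.

Lemma rigid_sym (T : finType) (e : rel T) C n p :
  symmetric e -> rigid e C n p -> rigid e C p n.
Proof.
move=> e_sym [nK pK Cn Cp np r1n r1p r2n r2p r3n r3p ind r4n r4p]; split=> //.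
- by move=> u /np /nesym.
- by move=> *; rewrite e_sym; eauto.
- by move=> *; rewrite e_sym; eauto.
- by move=> P u w Cu Cw Pu cP; apply: (ind P u) => // v /cP [].
Qed.

(** * Neighbours of a cycle that cannot be extended *)

Section Local.

Variables (T : finType) (e : rel T).
Hypotheses (e_sym : symmetric e) (e_irr : irreflexive e).
Hypothesis deg6 : forall v, #|nbhd e v| <= 6.
Hypothesis link2 : forall v a b, e v a -> e v b -> a <> b -> e a b = false ->
  exists c, [/\ e v c, e c a & e c b].

Lemma edge_neq a b : e a b -> a <> b.
Proof. by move=> eab ab; rewrite ab e_irr in eab. Qed.

Lemma degree_bound v s : uniq s -> all (e v) s -> size s <= 6.
Proof.
move=> Us /allP es; apply: leq_trans (deg6 v).
rewrite -(card_uniqP Us); apply: subset_leq_card; apply/subsetP => z /es evz.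
by rewrite inE.
Qed.

Lemma full_nbhd v s z :
  uniq s -> all (e v) s -> size s = 6 -> e v z -> z \in s.
Proof.
move=> Us es s6 evz; case zs: (z \in s) => //.
have: size (z :: s) <= 6 by apply: (@degree_bound v); rewrite /= ?zs ?evz.
by rewrite /= s6.
Qed.

Lemma separated (P : pred T) a b : P a = true -> P b = false -> a <> b.
Proof. by move=> Pa Pb ab; rewrite ab Pb in Pa. Qed.

(* Closes the context under symmetry of [e], and adds the disequality of the
   ends of every edge. *)
Ltac sat := unfold is_true in *;
  repeat match goal with
  | H : e ?a ?b = _ |- _ =>
      lazymatch goal with _ : e b a = _ |- _ => fail | _ =>
        pose proof (etrans (e_sym b a) H) end
  | H : e ?a ?b = true |- _ =>
      lazymatch goal with _ : a <> b |- _ => fail | _ : b <> a |- _ => fail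
      | _ => pose proof (edge_neq H) end
  end.
Ltac clash := solve [ match goal with
  | H1 : ?X = true, H2 : ?X = false |- _ => discriminate (etrans (esym H1) H2)
  | H : ?a <> ?a |- _ => case (H erefl)
  | H : ?a = ?b, K : ?a <> ?b |- _ => case (K H)
  | H : ?a = ?b, K : ?b <> ?a |- _ => case (K (esym H))
  | H : e ?a ?a = true |- _ => case (edge_neq H erefl)
  end ].
(* Refutes an equality of vertices by two facts that it makes contradictory. *)
Ltac refute E := lazymatch type of E with
  | _ = true => fail | _ = false => fail | ?f (?g ?a) = ?a => fail
  | ?a = ?b =>
  match goal with
  | _ => clash
  | H1 : ?P a = true, H2 : ?P b = false |- _ => case: (separated H1 H2 E)
  | H1 : ?P a = false, H2 : ?P b = true |- _ => case: (separated H2 H1 (esym E))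
  | H1 : e a ?c = true, H2 : e b ?c = false |- _ =>
      case: (@separated (e^~ c) _ _ H1 H2 E)
  | H1 : e a ?c = false, H2 : e b ?c = true |- _ =>
      case: (@separated (e^~ c) _ _ H2 H1 (esym E))
  end end.
Ltac refute_eq E := lazymatch type of E with
  | _ = true => fail | _ = false => fail | ?f (?g ?a) = ?a => fail
  | _ => first [ refute E |
  match goal with rC : rigid _ _ ?n ?p |- _ =>
    (generalize (congr1 n E) + generalize (congr1 p E));
    rewrite ?(rigid_nK rC) ?(rigid_pK rC);
    let F := fresh in intro F; refute F
  end ] end.
Ltac absurd_now := exfalso; first [ clash |
    match goal with E : _ = _ |- _ => refute_eq E end ].
Ltac fin := sat; try intro;
  solve [ trivial | assumption | absurd_now | subst; trivial
        | subst; assumption | subst; absurd_now ].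
Ltac dis := sat; rewrite /= ?inE ?negb_or;
  repeat (apply/andP; split);
  try match goal with |- is_true (negb (_ == _)) => apply/eqP end; fin.
(** [over] contradicts the degree bound by seven distinct neighbours of [v]; [full] locates [z]
    among six distinct neighbours that exhaust N(v). *)
Ltac over v s := exfalso; suff: size s <= 6 by [];
  apply: (@degree_bound v); dis.
Ltac full v s z H := have: z \in s;
  [ apply: (@full_nbhd v); try exact: erefl; dis
  | rewrite !inE => H; repeat case/orP: H => H; move/eqP: H => H].

Ltac cyc rC u := lazymatch type of rC with rigid _ ?C _ _ =>
  let Cu := constr:(ltac:(unfold is_true in *; eassumption) : is_true (C u)) in
  destruct (rigid_n rC Cu), (rigid_p rC Cu); pose proof (rigid_np rC Cu);
  pose proof (rigid_nK rC u); pose proof (rigid_pK rC u)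
  end.
Ltac off rC x u := lazymatch type of rC with rigid ?e ?C _ _ =>
  let Cx := constr:(ltac:(eassumption) : C x = false) in
  let Cu := constr:(ltac:(unfold is_true in *; eassumption) : is_true (C u)) in
  let exu :=
    constr:(ltac:(unfold is_true in *; eassumption) : is_true (e x u)) in
  pose proof (rigid1n rC Cx Cu exu); pose proof (rigid1p rC Cx Cu exu)
  end.

(** The link of [x] and [n u] in N(u) is on [C]: a vertex off [C] adjacent to both [u] and [n u]
    could be inserted between them. *)
Lemma cover_n C n p x u : rigid e C n p -> C x = false -> C u -> e x u ->
  exists t, [/\ C t, e x t, e u t & e t (n u)].
Proof.
move=> rC Cx Cu exu; off rC x u; cyc rC u.
have [|//|||t [eut etx etn]] := @link2 u x (n u); sat; try fin.
exists t; split=> //; sat; try fin.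
case Ct: (C t) => //.
by have := rigid1n rC Ct Cu ltac:(fin); fin.
Qed.

Lemma cover_p C n p x u : rigid e C n p -> C x = false -> C u -> e x u ->
  exists t, [/\ C t, e x t, e u t & e t (p u)].
Proof. by move/(rigid_sym e_sym); apply: cover_n. Qed.

(* N(t) would be {n t, p t, x, u, n u, p u}, where only [u] can link [x] to [n t]
   and to [p t]; then [u] has seven neighbours, one of them [y]. *)
Lemma off_triangle_cover C n p x y u t : rigid e C n p ->
  C x = false -> C y = false -> C u -> e x y -> e x u -> e y u ->
  C t -> e x t -> e u t -> e t (n u) -> e t (p u) -> False.
Proof.
move=> rC Cx Cy Cu exy exu eyu Ct ext eut etn etp.
cyc rC u; cyc rC t; off rC x u; off rC y u; off rC x t.
have tnn : n t <> p u.
  by move=> E; apply: (rigid4n rC Cx Cy Ct exy ext); rewrite E (rigid_pK rC).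
have tpp : p t <> n u.
  by move=> E; apply: (rigid4p rC Cx Cy Ct exy ext); rewrite E (rigid_nK rC).
have [a [Ca exa eta ea]] := cover_n rC Cx Ct ext.
have [b [Cb exb etb eb]] := cover_p rC Cx Ct ext.
have au : a = u.
  full t [:: n t; p t; x; u; n u; p u] a A; sat; fin.
have bu : b = u.
  full t [:: n t; p t; x; u; n u; p u] b A; sat; fin.
subst a b.
over u [:: n u; p u; x; y; t; n t; p t].
Qed.

(** The vertices covering [n u] and [p u] from [x] differ by [off_triangle_cover], so together with
    [n u], [p u], [x], [y] they exhaust N(u). Hence [p u] is covered from [y] by the same vertex as
    from [x]. *)
Lemma off_triangle C n p x y u : rigid e C n p ->
  C x = false -> C y = false -> C u -> e x y -> e x u -> e y u ->
  (exists t, [/\ C t, e x t, e y t, e u t & e t (p u)]) /\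
  (forall z, C z -> e u z -> z <> n u -> z <> p u -> e x z).
Proof.
move=> rC Cx Cy Cu exy exu eyu.
have no t := @off_triangle_cover C n p x y u t rC Cx Cy Cu exy exu eyu.
cyc rC u; off rC x u; off rC y u.
have [a [Ca exa eua ea]] := cover_n rC Cx Cu exu.
have [b [Cb exb eub eb]] := cover_p rC Cx Cu exu.
have [c [Cc eyc euc ec]] := cover_p rC Cy Cu eyu.
have ab : a <> b by move=> E; apply: (no a); rewrite // E.
split.
  exists b; split=> //; full u [:: n u; p u; x; y; a; b] c E; try fin.
  by exfalso; apply: (no a); rewrite -?E //; fin.
by move=> z Cz euz zn zp; full u [:: n u; p u; x; y; a; b] z E; fin.
Qed.

(** A neighbour [z] off [C] would produce a triangle [x], [y], [v] with only [v] on [C]. Then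
    [off_triangle], applied at [v] and again at the vertex [t] it yields, makes [x] adjacent to
    [p v], against [rigid1p]. *)
Lemma off_nbhd C n p x u z : rigid e C n p ->
  C x = false -> C u -> e x u -> e x z -> C z.
Proof.
move=> rC Cx Cu exu exz; case Cz: (C z) => //; exfalso.
have [y [v [Cy Cv exy exv eyv]]] :
    exists y v, [/\ C y = false, C v, e x y, e x v & e y v].
  case euz: (e u z); first by exists z, u; split=> //; fin.
  have [|c [exc ecu ecz]] := link2 exu exz _ euz; first by fin.
  case Cc: (C c); first by exists z, c; split=> //; fin.
  by exists c, u; split.
have [[t [Ct ext eyt evt etp]] _] := off_triangle rC Cx Cy Cv exy exv eyv.
have [_ sub] := off_triangle rC Cx Cy Ct exy ext eyt.
cyc rC v; cyc rC t; off rC x v; off rC y v.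
have: e x (p v); last by fin.
apply: sub => //; last by fin.
by move=> E; apply: (rigid4n rC Cx Cy Ct exy ext); rewrite -E (rigid_pK rC).
Qed.

(** * Alternation of the cycle around a vertex off it with three neighbours *)

Section Star.

Variables (C : pred T) (x : T).
Hypotheses (Cx : C x = false) (Ux : forall z, e x z -> C z).
Hypothesis third : forall a b, exists z, [/\ e x z, z <> a & z <> b].

(** As [x] is never adjacent to two consecutive vertices of [C], closure under double steps makes
    [C] alternate between N(x) and its complement. *)
Definition alternating (n p : T -> T) :=
  (forall u, e x u -> e x (n (n u))) /\ (forall u, e x u -> e x (p (p u))).

Lemma alternating_sym n p : alternating n p -> alternating p n.
Proof. by case. Qed.

Ltac on rC u := have := Ux (ltac:(eassumption) : is_true (e x u)); intro;
  cyc rC u; off rC x u.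

Lemma no_square n p u t : rigid e C n p -> e x u -> e x t ->
  n (n u) = t -> n (n t) = u -> False.
Proof.
move=> rC exu ext ut tu; on rC u; on rC t.
have [z [exz zu zt]] := third u t; on rC z.
have: z \in [:: u; n u; t; n t].
  apply: (rigid_ind rC (P := mem [:: u; n u; t; n t]) (u := u)) => //.
    exact: mem_head.
  have pu : p u = n t by rewrite -tu (rigid_nK rC).
  have pt : p t = n u by rewrite -ut (rigid_nK rC).
  move=> v; rewrite !inE => /or4P [] /eqP ->;
    by rewrite ?ut ?tu ?(rigid_nK rC) ?pu ?pt !eqxx ?orbT.
by rewrite !inE => /or4P [] /eqP E; fin.
Qed.

(** [C] is the hexagon [a], [n a], [b], [n b], [c], [n c], in which [x] sees exactly [a], [b], [c].
    The neighbour counts below lead to this configuration. *)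
Lemma hexagon_alternating n p a b c : rigid e C n p ->
  e x a -> e x b -> e x c -> n (n a) = b -> n (n b) = c -> n (n c) = a ->
  alternating n p.
Proof.
move=> rC exa exb exc ab bc ca; on rC a; on rC b; on rC c.
have pa : p a = n c by rewrite -ca (rigid_nK rC).
have pb : p b = n a by rewrite -ab (rigid_nK rC).
have pc : p c = n b by rewrite -bc (rigid_nK rC).
have abc z : e x z -> [\/ z = a, z = b | z = c].
  move=> exz; on rC z.
  have: z \in [:: a; b; c; n a; n b; n c].
    pose P : pred T := mem [:: a; b; c; n a; n b; n c].
    apply: (rigid_ind rC (P := P) (u := a)) => //.
      exact: mem_head.
    move=> v; rewrite /P !inE => V; repeat case/orP: V => V;
      by rewrite (eqP V) ?ab ?bc ?ca ?(rigid_nK rC) ?pa ?pb ?pc !eqxx ?orbT.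
  rewrite !inE => V; repeat case/orP: V => V; move/eqP: V => V;
    by [apply: Or31 | apply: Or32 | apply: Or33 | exfalso; fin].
by split=> z /abc [] ->; rewrite ?ab ?bc ?ca ?pa ?pb ?pc ?(rigid_nK rC).
Qed.

(** Links from the leaf [u] inside N(x) pass through [t], so [t] is adjacent to the rest of N(x).
    Then N(t) is full, which leaves N(x) = {u, t, z}; [z] is a leaf too, so [n z] and [p z] are in
    N(t), and this closes a hexagon. *)
Lemma leaf_one_side n p u t : rigid e C n p -> e x u -> e x t ->
  (forall z, e x z -> e u z -> z = t) -> n u = p t -> alternating n p.
Proof.
move=> rC exu ext leaf nu; on rC u; on rC t.
have ut z : e x z -> z <> u -> z <> t -> e t z.
  move=> exz zu zt; case euz: (e u z); first by case: zt; apply: leaf.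
  have [|c [exc ecu ecz]] := link2 exu exz _ euz; first by fin.
  by have <- : c = t by apply: leaf; rewrite // e_sym.
have [c [_ exc euc etp]] := cover_p rC Cx (Ux exu) exu.
have ct := leaf c exc euc; subst c.
have [z [exz zu zt]] := third u t; have etz := ut z exz zu zt; on rC z.
have nnu : n (n u) = t by rewrite nu (rigid_pK rC).
have pnt : p u <> n t.
  by move=> E; apply: (@no_square n p u t); rewrite // -E (rigid_pK rC).
have nutz v : e t v -> v \in [:: x; n t; p t; u; p u; z].
  by apply: full_nbhd => //; dis.
have other c : e x c -> [\/ c = u, c = t | c = z].
  move=> exc'; on rC c; case: (c =P u) => [->|cu]; first exact: Or31.
  case: (c =P t) => [->|ct]; first exact: Or32.
  have := nutz c (ut c exc' cu ct); rewrite !inE => V.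
  by repeat case/orP: V => V; move/eqP: V => V; apply: Or33; fin.
have zleaf c : e x c -> e z c -> c = t.
  move=> exc' ezc; case: (other c exc') => E //; last by exfalso; fin.
  by exfalso; apply: zt; apply: leaf; fin.
have [c [_ exc' ezc ecz]] := cover_n rC Cx (Ux exz) exz.
have ct := zleaf c exc' ezc; subst c.
have [c [_ exc'' ezc' ecz']] := cover_p rC Cx (Ux exz) exz.
have ct := zleaf c exc'' ezc'; subst c.
have nz : n z = p u.
  by full t [:: x; n t; p t; u; p u; z] (n z) E; fin.
have pz : p z = n t.
  by full t [:: x; n t; p t; u; p u; z] (p z) E; fin.
apply: (@hexagon_alternating n p u t z); rewrite //.
  by rewrite -pz (rigid_pK rC).
by rewrite nz (rigid_pK rC).
Qed.

(** Both [n u] and [p u] are covered by [t]. Unless [u] and [t] are two steps apart on the cycle,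
    this gives [t] seven neighbours. *)
Lemma leaf_alternating n p u t : rigid e C n p -> e x u ->
  (forall z, e x z -> e u z -> z = t) -> alternating n p.
Proof.
move=> rC exu leaf.
have [c [_ ext eut etn]] := cover_n rC Cx (Ux exu) exu.
have ct := leaf c ext eut; subst c.
have [c [_ ext' eut' etp]] := cover_p rC Cx (Ux exu) exu.
have ct := leaf c ext' eut'; subst c.
case: (n u =P p t) => [E|nu]; first exact: (leaf_one_side rC exu ext).
case: (p u =P n t) => [E|pu].
  apply: alternating_sym.
  exact: (leaf_one_side (rigid_sym e_sym rC) exu ext).
have [z [exz zu zt]] := third u t; on rC u; on rC t; on rC z.
have etz : e t z.
  case euz: (e u z); first by case: zt; apply: leaf.
  have [|d [exd edu edz]] := link2 exu exz _ euz; first by fin.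
  by have <- : d = t by apply: leaf; rewrite // e_sym.
over t [:: x; n t; p t; u; n u; p u; z].
Qed.

(** * The case where every vertex of N(x) has two neighbours in N(x) *)

Section NoLeaf.

Hypothesis no_leaf : forall u t, e x u -> exists z, [/\ e x z, e u z & z <> t].

(** The last clause rules out a 4-cycle, so that the edge from [t] to [n w] is a chord of [C]. *)
Definition forward_pair (n p : T -> T) t w :=
  [/\ e x t, e t w, n (n t) = w, e t (n w) & n w <> p t].

Ltac two_nbrs rC u t a b :=
  have [a [? ? ?]] := no_leaf t (ltac:(eassumption) : is_true (e x u));
  have [b [? ? ?]] := no_leaf a (ltac:(eassumption) : is_true (e x u));
  on rC a; on rC b.

(* By [rigid3n] the vertices [n w] and [p w] are nonadjacent, so they have a
   common neighbour [t] in N(w); its degree forces it to be two steps from [w]. *)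
Lemma slot_pair n p w u : rigid e C n p -> e x w -> e x u -> u <> w ->
  e w (n u) -> n u <> p w ->
  exists t, forward_pair n p t w \/ forward_pair p n t w.
Proof.
move=> rC exw exu uw ewn nupw; on rC w; on rC u.
have npw := rigid3n rC Cx (Ux exu) (Ux exw) uw exu exw ewn.
have [||//||t [ewt etn etp]] := @link2 w (n w) (p w); try fin.
have nunw := rigid2n rC Cx (Ux exu) (Ux exw) uw exu exw.
two_nbrs rC w w a b.
have ext : e x t.
  by full w [:: x; n w; p w; n u; a; b] t E; fin.
exists t; on rC t.
case: (n t =P p w) => [ntp|ntp]; case: (p t =P n w) => [ptn|ptn].
- case: (@no_square n p w t); rewrite // -?ntp ?(rigid_pK rC) //.
    by rewrite -ptn (rigid_pK rC).
  by rewrite ntp (rigid_pK rC).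
- left; split=> //; [by fin | by rewrite ntp (rigid_pK rC) | exact: nesym].
- right; split=> //; [by fin | by rewrite ptn (rigid_nK rC) | exact: nesym].
- by two_nbrs rC t t a' b'; over t [:: x; n t; p t; n w; p w; a'; b'].
Qed.

(** The chord from [t] to [n w] allows [slot_pair] at [t]. A backward pair is [w] itself, which
    gives the edge. A forward pair is some [t'] two steps before [t]; if [w] misses [p t], then [t']
    must link [n w] to [p t] in N(t), and its own full neighbourhood closes the hexagon through
    [t'], [t], [w]. *)
Lemma forward_pair_mutual n p t w : rigid e C n p -> e x w ->
  forward_pair n p t w -> e (n w) (p w) = false ->
  alternating n p \/ e w (p t).
Proof.
move=> rC exw [ext etw ntw etn nwpt] npw; on rC w; on rC t.
have ntp : n t = p w by rewrite -ntw (rigid_nK rC).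
have [|t' [[ext' et't nt' et'n npt]|[ext' et't nt' et'p npt]]] :=
    slot_pair rC ext exw _ etn nwpt; first by fin.
  case ewp: (e w (p t)); first by right.
  left; on rC t'.
  have tw' : t' <> w by move=> E; apply: npt; rewrite E.
  have pt : p t = n t' by rewrite -nt' (rigid_nK rC).
  have nwt' : e (n w) (p t) = false.
    by rewrite pt; apply: (rigid2n rC Cx) => //; fin.
  have [||//||c [etc ecn ecp]] := @link2 t (n w) (p t); try fin.
  have et'w : e t' (n w).
    by full t [:: x; p t; n t; n w; w; t'] c E; try fin.
  have nw : n w = p t'.
    two_nbrs rC t' t' a b.
    by full t' [:: x; n t'; p t'; n t; a; b] (n w) E; fin.
  apply: (@hexagon_alternating n p t' t w) => //.
  by rewrite nw (rigid_pK rC).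
by right; have <- : t' = w by rewrite -ntw -nt' !(rigid_pK rC).
Qed.

(** N(t) consists of [x], [p t], [n t], [n w], [w] and one more vertex [a] of N(x). Whether or not
    [a] is adjacent to [w], the links force [n a = p t] and [p a = n w], a hexagon through [t], [w],
    [a]. *)
Lemma mutual_alternating n p t w : rigid e C n p -> e x w ->
  forward_pair n p t w -> e w (p t) -> alternating n p.
Proof.
move=> rC exw [ext etw ntw etn nwpt] ewp; on rC w; on rC t.
have ntp : n t = p w by rewrite -ntw (rigid_nK rC).
have hw : e (n w) (p w) = false.
  by apply: (rigid3p rC Cx (Ux ext)) => //; fin.
have ht : e (n t) (p t) = false.
  by apply: (rigid3n rC Cx (Ux exw)) => //; fin.
have [a [exa eta aw]] := no_leaf w ext.
have [b [exb ewb bt]] := no_leaf t exw.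
on rC a; on rC b.
have npt v : e t v -> v \in [:: x; p t; n t; n w; w; a].
  by apply: full_nbhd => //; dis.
case eaw: (e a w).
  have nw v : e w v -> v \in [:: x; p w; n w; p t; t; a].
    by apply: full_nbhd => //; dis.
  (* A further vertex [z] of N(x) can be linked to [t] inside N(x) only through [a]. *)
  have out z : e x z -> z <> t -> z <> w -> z <> a ->
      [/\ e t z = false, e w z = false & e a z].
    move=> exz zt zw za; on rC z.
    have etz : e t z = false.
      apply/negP => /npt; rewrite !inE => E.
      by repeat case/orP: E => E; move/eqP: E => E; fin.
    have ewz : e w z = false.
      apply/negP => /nw; rewrite !inE => E.
      by repeat case/orP: E => E; move/eqP: E => E; fin.
    split=> //; have [||//||d [exd edt edz]] := @link2 x t z; try fin.
    on rC d; have := npt d; rewrite inE e_sym edt => /(_ isT) E.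
    move: E; rewrite !inE => E.
    by repeat case/orP: E => E; move/eqP: E => E; fin.
  (* Such a [z] would have a second neighbour [c] of the same kind, by [no_leaf], giving [a] seven
     neighbours. *)
  have all3 z : e x z -> [\/ z = t, z = w | z = a].
    move=> exz; case: (z =P t) => [->|zt]; first exact: Or31.
    case: (z =P w) => [->|zw]; first exact: Or32.
    case: (z =P a) => [->|za]; first exact: Or33.
    have [etz ewz eaz] := out z exz zt zw za.
    have [c [exc ezc ca]] := no_leaf a exz.
    have [||_ _ eac] := out c exc _ _ ca; try by move=> E; fin.
    on rC z; on rC c; over a [:: x; n a; p a; t; w; z; c].
  have [c [_ exc eac ecn]] := cover_n rC Cx (Ux exa) exa.
  have [d [_ exd ead edp]] := cover_p rC Cx (Ux exa) exa.
  have na : n a = p t.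
    have [] := all3 c exc => E; subst c; last by fin.
      have := npt _ ecn; rewrite !inE => E.
      by repeat case/orP: E => E; move/eqP: E => E; fin.
    have := nw _ ecn; rewrite !inE => E.
    by repeat case/orP: E => E; move/eqP: E => E; fin.
  have pa : p a = n w.
    have [] := all3 d exd => E; subst d; last by fin.
      have := npt _ edp; rewrite !inE => E.
      by repeat case/orP: E => E; move/eqP: E => E; fin.
    have := nw _ edp; rewrite !inE => E.
    by repeat case/orP: E => E; move/eqP: E => E; fin.
  apply: (@hexagon_alternating n p t w a) => //.
    by rewrite -pa (rigid_pK rC).
  by rewrite na (rigid_pK rC).
have na2n := rigid2n rC Cx (Ux exa) (Ux exw) aw exa exw.
have at2p := rigid2p rC Cx (Ux exa) (Ux ext).
(* The link runs inside the six vertices of N(t); it is not [x], which misses [z], nor [w], which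
   misses [a]. *)
have link z : e t z -> a <> z -> e a z = false -> e x z = false ->
    exists2 c, c \in [:: p t; n t; n w] & e c a && e c z.
  move=> etz az eaz exz; have [||||c [etc eca ecz]] := @link2 t a z; rewrite //.
  exists c; last by rewrite eca ecz.
  have := npt c etc; rewrite !inE => V.
  by repeat case/orP: V => V; rewrite ?V ?orbT //; move/eqP: V => V; fin.
have ean : e a (n t).
  case E: (e a (n t)) => //.
  have [||||c] := link (n t); rewrite //; first by fin.
  rewrite !inE => V /andP [eca ecn].
  by repeat case/orP: V => V; move/eqP: V => V; fin.
two_nbrs rC a t c1 c2.
have nba v : e a v -> v \in [:: x; n a; p a; n t; c1; c2].
  by apply: full_nbhd => //; dis.
have pan z : e a z -> e x z = false -> z <> x -> z <> n t -> z = n a \/ z = p a.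
  move=> eaz exz zx znt; have := nba z eaz; rewrite !inE => V.
  by repeat case/orP: V => V; move/eqP: V => V;
    [fin | left | right | fin | fin | fin].
(* If [a] missed [p t], only [n w] could link them; then [p a = n w] would be adjacent to [p t],
   against [rigid2p]. *)
have na : n a = p t.
  case E: (e a (p t)).
    by case: (pan (p t)); rewrite //; fin.
  have [||||c] := link (p t); rewrite //; first by fin.
  rewrite !inE => V /andP [eca ecp].
  have cw : c = n w by repeat case/orP: V => V; move/eqP: V => V; fin.
  subst c; case: (pan (n w)); try fin; move=> pa; exfalso.
  by have ataw := at2p ltac:(fin) exa ext; rewrite -pa in ataw; fin.
have pa : p a = n w.
  case E: (e a (n w)).
    by case: (pan (n w)); rewrite //; fin.
  have [||||c] := link (n w); rewrite //; first by fin.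
  rewrite !inE => V /andP [eca ecp].
  by repeat case/orP: V => V; move/eqP: V => V; fin.
apply: (@hexagon_alternating n p t w a) => //.
  by rewrite -pa (rigid_pK rC).
by rewrite na (rigid_pK rC).
Qed.

Lemma slot_alternating n p w u : rigid e C n p -> e x w -> e x u -> u <> w ->
  e w (n u) -> n u <> p w -> alternating n p.
Proof.
move=> rC exw exu uw ewn nupw.
have npw := rigid3n rC Cx (Ux exu) (Ux exw) uw exu exw ewn.
have [t [F|F]] := slot_pair rC exw exu uw ewn nupw.
  have [//|ewp] := forward_pair_mutual rC exw F npw.
  exact: mutual_alternating rC exw F ewp.
have rC' := rigid_sym e_sym rC; apply: alternating_sym.
have [|//|ewp] := forward_pair_mutual rC' exw F; first by rewrite e_sym.
exact: mutual_alternating rC' exw F ewp.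
Qed.

(** The vertex covering [n u] either lies two steps after [u] or supplies the edge required by
    [slot_alternating]. *)
Lemma no_leaf_next n p u : rigid e C n p -> e x u ->
  alternating n p \/ e x (n (n u)).
Proof.
move=> rC exu; have [c [_ exc euc ecn]] := cover_n rC Cx (Ux exu) exu.
case: (n u =P p c) => [->|nc]; first by right; rewrite (rigid_pK rC).
left; apply: (slot_alternating rC exc exu) => //; exact: edge_neq.
Qed.

End NoLeaf.

Lemma star_alternating n p : rigid e C n p -> alternating n p.
Proof.
move=> rC.
case leaf: [exists u, exists t,
    e x u && [forall z, e x z ==> e u z ==> (z == t)]].
  case/existsP: leaf => u /existsP [t /andP [exu /forallP ut]].
  apply: (leaf_alternating rC exu (t := t)) => z exz euz.
  by have /implyP/(_ exz)/implyP/(_ euz)/eqP := ut z.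
have no_leaf u t : e x u -> exists z, [/\ e x z, e u z & z <> t].
  move=> exu; move/existsP: leaf => leaf.
  case E: [exists z, [&& e x z, e u z & z != t]].
    by case/existsP: E => z /and3P [? ? /eqP ?]; exists z.
  case: leaf; exists u; apply/existsP; exists t; rewrite exu /=.
  apply/forallP => z; apply/implyP => exz; apply/implyP => euz.
  by apply: contraFT E => zt; apply/existsP; exists z; rewrite exz euz zt.
split=> u exu.
  by have [[]|] := no_leaf_next no_leaf rC exu; auto.
by have [[]|] := no_leaf_next no_leaf (rigid_sym e_sym rC) exu; auto.
Qed.

End Star.
End Local.

(** * Rerouting a cycle *)

Section Splitting.

Variable T : eqType.
Implicit Types (s : seq T) (y w : T).

Lemma next_split y s1 w s2 : w \notin y :: s1 ->
  next (y :: s1 ++ w :: s2) w = head y s2.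
Proof.
rewrite inE negb_or next_nth -cat_cons mem_cat mem_head orbT.
rewrite /= eq_sym => /andP [/negbTE -> /negbTE wN].
rewrite index_cat wN /= eqxx addn0 nth_cat ltnNge leqnSn.
by rewrite subSnn -nth0.
Qed.

Lemma prev_split y s1 w s2 : w \notin y :: s1 ->
  prev (y :: s1 ++ w :: s2) w = last y s1.
Proof.
rewrite inE negb_or prev_nth -cat_cons mem_cat mem_head orbT.
case/andP=> _ /negbTE wN; rewrite /= index_cat wN /= eqxx addn0.
rewrite -cat_cons nth_cat /= ltnSn; exact: (nth_last y (y :: s1)).
Qed.

Lemma perm_detour_rev x y w s1 s2 :
  perm_eq (y :: x :: w :: rev s1 ++ s2) (x :: y :: s1 ++ w :: s2).
Proof.
apply/permP => P; rewrite /= !count_cat /= count_rev.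
by rewrite addnCA; do 2 congr (_ + _); rewrite addnCA.
Qed.

Lemma perm_detour x y w s1 s2 :
  perm_eq (y :: x :: w :: s1 ++ s2) (x :: y :: s1 ++ w :: s2).
Proof.
apply/permP => P; rewrite /= !count_cat /=.
by rewrite addnCA; do 2 congr (_ + _); rewrite addnCA.
Qed.

End Splitting.

Section Rerouting.

Variables (T : finType) (e : rel T) (H : pred T) (k : nat).
Hypotheses (e_sym : symmetric e) (e_irr : irreflexive e).
Hypothesis H_closed : forall a b, e a b -> H a -> H b.
Hypothesis maximal : forall s, cycle e s -> uniq s -> all H s -> size s <> k.+1.

Definition kcycle (c : seq T) := [/\ uniq c, cycle e c, all H c & size c = k].

Lemma kcycle_head c u : kcycle c -> u \in c ->
  exists s, [/\ kcycle (u :: s), u :: s =i c,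
    next (u :: s) =1 next c & prev (u :: s) =1 prev c].
Proof.
move=> [Uc ec Hc kc] /rot_to [i s E]; exists s; rewrite -E.
split; [split | exact: mem_rot | exact: next_rot | exact: prev_rot].
- by rewrite rot_uniq.
- by rewrite rot_cycle.
- by rewrite (eq_all_r (mem_rot i c)).
- by rewrite size_rot.
Qed.

(** The first three reroutings below rearrange [x :: c], so each would be a cycle of the excluded
    length. *)
Lemma no_extension c x s : kcycle c -> x \notin c -> H x ->
  perm_eq s (x :: c) -> cycle e s = false.
Proof.
move=> [Uc ec Hc kc] xc Hx sxc; apply/negP => es; apply: (maximal es).
- by rewrite (perm_uniq sxc) /= xc.
- by rewrite (perm_all _ sxc) /= Hx.
- by rewrite (perm_size sxc) /= kc.
Qed.

Lemma kcycle_H c x u : kcycle c -> u \in c -> e x u -> H x.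
Proof.
by move=> [_ _ /allP Hc _] /Hc Hu exu; rewrite (H_closed _ Hu) // e_sym.
Qed.

Lemma reroute1 c x u : kcycle c ->
  x \notin c -> u \in c -> e x u -> e x (next c u) = false.
Proof.
move=> kc xc uc exu; have Hx := kcycle_H kc uc exu.
have [s [{}kc sc nc _]] := kcycle_head kc uc.
move: xc; rewrite -nc -sc => xc; apply/negP.
case: s kc {sc nc} xc => [|a s] kc xc.
  by move: (kc) => [_]; rewrite /= e_irr.
have [_ + _ _] := kc; rewrite /= eqxx => /andP [eua es] exa.
have: cycle e (u :: x :: a :: s) by rewrite /= e_sym exu exa.
by rewrite (no_extension kc xc Hx) //; apply/permP => P /=; rewrite addnCA.
Qed.

Lemma split_kcycle c x u w : kcycle c -> x \notin c ->
  u \in c -> w \in c -> u <> w -> e x u -> e x w ->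
  exists a s1 s2, let c' := u :: (a :: s1) ++ w :: s2 in
    [/\ kcycle c', x \notin c', H x, next c u = a &
        next c w = head u s2 /\ prev c w = last a s1].
Proof.
move=> kc xc uc wc uw exu exw; have Hx := kcycle_H kc uc exu.
have exn := reroute1 kc xc uc exu.
have [s [{}kc sc nc pc]] := kcycle_head kc uc.
move: wc; rewrite -sc inE => /predU1P [wu|ws]; first by case: uw.
move: exn xc; rewrite -!nc -pc -sc => exn xc.
case/splitPr: ws kc exn xc {sc nc pc} => s1 s2 kc exn xc.
have ws : w \notin u :: s1.
  have [+ _ _ _] := kc; rewrite -cat_cons cat_uniq /= negb_or.
  by case/and3P => _ /andP [].
rewrite next_split // prev_split //.
case: s1 kc exn xc ws => [|a s1] kc; rewrite /= ?eqxx ?exw // => _ xc _.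
by exists a, s1, s2.
Qed.

(** The forbidden cycle runs [u], [x], [w], back along [c] to [next c u], then across to [next c w]
    and on to [u]. *)
Lemma reroute2 c x u w : kcycle c -> x \notin c -> u \in c -> w \in c ->
  u <> w -> e x u -> e x w -> e (next c u) (next c w) = false.
Proof.
move=> kc xc uc wc uw exu exw; apply/negP.
have [a [s1 [s2 [{}kc {}xc Hx -> [-> _]]]]] :=
  split_kcycle kc xc uc wc uw exu exw.
have [_ + _ _] := kc.
rewrite /= rcons_cat cat_path /= => /and4P [eua es1 esw es2] eah.
have: cycle e (u :: x :: w :: rev (a :: s1) ++ s2).
  rewrite /= e_sym exu exw /= rcons_cat cat_path; apply/andP; split.
    have := rev_path e a (rcons s1 w).
    rewrite last_rcons belast_rcons => ->.
    by rewrite (eq_path (e' := e)) ?rcons_path ?es1 // => y z; rewrite /= e_sym.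
  by rewrite rev_cons last_rcons; case: s2 es2 eah {kc xc} => [|b s2] /=;
    [move=> _ -> | case/andP => _ -> ->].
by rewrite (no_extension kc xc Hx) //; exact: perm_detour_rev.
Qed.

(** Here [w] is moved: [u], [x], [w], [next c u], along [c] to [prev c w], then directly to
    [next c w]. *)
Lemma reroute3 c x u w : kcycle c -> x \notin c -> u \in c -> w \in c ->
  u <> w -> e x u -> e x w -> e w (next c u) -> e (next c w) (prev c w) = false.
Proof.
move=> kc xc uc wc uw exu exw; rewrite (e_sym (next c w)) => ewn; apply/negP.
move: ewn; have [a [s1 [s2 [{}kc {}xc Hx -> [-> ->]]]]] :=
  split_kcycle kc xc uc wc uw exu exw.
have [_ + _ _] := kc.
rewrite /= rcons_cat cat_path /= => /and4P [eua es1 esw es2] ewa elh.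
have: cycle e (u :: x :: w :: a :: s1 ++ s2).
  rewrite /= e_sym exu exw ewa rcons_cat cat_path es1.
  by case: s2 es2 elh {kc xc} => [|b s2] /=;
    [move=> _ -> | case/andP => _ -> ->].
by rewrite (no_extension kc xc Hx) //; exact: (perm_detour _ _ _ (a :: s1)).
Qed.

(** The two vertices [x], [y] would replace the single vertex [next c u]. *)
Lemma reroute4 c x y u : kcycle c -> 2 < k -> x \notin c -> y \notin c ->
  u \in c -> e x y -> e x u -> e y (next c (next c u)) -> False.
Proof.
move=> kc k3 xc yc uc exy exu; have Hx := kcycle_H kc uc exu.
have Hy := H_closed exy Hx.
have [s [{}kc sc nc _]] := kcycle_head kc uc.
move: xc yc; rewrite -!nc -!sc.
case: s kc {sc nc} => [|m [|q s]] kc xc yc;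
  try by case: kc => _ _ _ /= ks; rewrite -ks in k3.
have [Uc + Hc ks] := kc; rewrite /= eqxx => /and3P [eum emq es].
have mu : (m == u) = false.
  by move: Uc; rewrite /= inE negb_or eq_sym => /andP [/andP [/negbTE]].
rewrite mu eqxx => eyq.
apply: (maximal (s := u :: x :: y :: q :: s)).
- by rewrite /= e_sym exu exy eyq.
- rewrite (@perm_uniq _ _ [:: x, y, u, q & s]).
    have sub : {subset u :: q :: s <= [:: u, m, q & s]}.
      by move=> z; rewrite !inE => /or3P [] ->; rewrite ?orbT.
    have Uq : uniq (u :: q :: s).
      by move: Uc; rewrite /= inE negb_or => /and3P [/andP [_ ->] _ ->].
    have xy : (x == y) = false by apply/eqP => xy; rewrite xy e_irr in exy.
    rewrite cons_uniq [uniq (y :: _)]cons_uniq Uq andbT inE xy /=.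
    by rewrite (contra (sub x) xc) (contra (sub y) yc).
  by apply/permP => P /=; rewrite addnCA; congr addn; rewrite addnCA.
- by move: Hc; rewrite /= Hx Hy => /and4P [-> _ -> ->].
- by rewrite -ks.
Qed.

Lemma kcycle_rev c : kcycle c -> kcycle (rev c).
Proof.
move=> [Uc ec Hc kc]; split; rewrite ?rev_uniq ?all_rev ?size_rev //.
by rewrite rev_cycle (eq_cycle (e' := e)) // => y z; rewrite /= e_sym.
Qed.

Lemma next_neq_prev c u : kcycle c -> 2 < k -> u \in c -> next c u <> prev c u.
Proof.
move=> kc k3 uc E; have [Uc0 _ _ _] := kc.
have := next_prev Uc0 u; rewrite -E.
have [s [{E}kc' _ nc _]] := kcycle_head kc uc; rewrite -!nc.
case: kc' {nc} => Uc _ _ ks; case: s ks Uc => [|a [|b s]] ks;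
  try by rewrite -ks in k3.
rewrite /= eqxx !inE !negb_or => /and3P [/and3P [ua ub _] _ _].
by rewrite eq_sym (negbTE ua) eqxx => bu; rewrite bu eqxx in ub.
Qed.

Lemma kcycle_ind c (P : pred T) u w : kcycle c -> u \in c -> w \in c -> P u ->
  (forall v, P v -> P (next c v)) -> P w.
Proof.
move=> [Uc _ _ _] uc wc Pu Pn.
have: fconnect (next c) u w by rewrite (fconnect_cycle (cycle_next Uc)).
move/iter_findex <-; elim: (findex _ _ _) => //= m; exact: Pn.
Qed.

(** The statements about [prev] come from those about [next] on the reversed cycle. *)
Lemma kcycle_rigid c : kcycle c -> 2 < k ->
  rigid e (mem c) (next c) (prev c).
Proof.
move=> kc k3; have [Uc ec Hc _] := kc.
have kr := kcycle_rev kc; have pc := next_rev Uc.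
have nc : prev (rev c) =1 next c by exact: prev_rev.
have rc u : u \in c -> u \in rev c by rewrite mem_rev.
have rn u : (u \in c) = false -> u \notin rev c by rewrite mem_rev => ->.
split=> /=; first exact: prev_next.
- exact: next_prev.
- by move=> u uc; rewrite mem_next next_cycle.
- by move=> u uc; rewrite mem_prev e_sym prev_cycle.
- by move=> u uc; exact: next_neq_prev.
- by move=> x u /negbT xc uc; exact: reroute1.
- by move=> x u /rn xc /rc uc; rewrite -pc; exact: reroute1.
- by move=> x u w /negbT xc uc wc; exact: reroute2.
- by move=> x u w /rn xc /rc uc /rc wc; rewrite -!pc; exact: reroute2.
- by move=> x u w /negbT xc uc wc; exact: reroute3.
- move=> x u w /rn xc /rc uc /rc wc uw exu exw ewp; rewrite e_sym -nc.
  move: ewp; rewrite -!pc. exact: (reroute3 kr xc uc wc uw exu exw).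
- move=> P u w uc wc Pu cP; apply: (kcycle_ind kc uc wc Pu) => v /cP [] //.
- by move=> x y u /negbT xc /negbT yc uc; exact: reroute4.
- by move=> x y u /rn xc /rn yc /rc uc; rewrite -!pc; exact: reroute4.
Qed.


Lemma swap_kcycle c x u : kcycle c -> 2 < k -> x \notin c -> u \in c ->
  e x u -> e x (next c (next c u)) -> exists c',
    [/\ kcycle c', u \in c', next c u \notin c' &
        forall z, z \in c' -> z = x \/ z \in c].
Proof.
move=> kc k3 xc uc exu; have Hx := kcycle_H kc uc exu.
have [s [{}kc sc nc _]] := kcycle_head kc uc.
move: xc; rewrite -!nc -!sc => xc.
have sub z : z \in u :: s -> z \in c by rewrite sc.
case: s kc xc {nc sc} sub => [|y [|w s]] kc xc sub;
  try by case: kc => _ _ _ /= ks; rewrite -ks in k3.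
have [Uc + Hc ks] := kc; rewrite /= eqxx => /and3P [euy eyw es].
have [uy us] : (y == u) = false /\ y \notin [:: u, w & s].
  move: Uc; rewrite /= !inE !negb_or eq_sym.
  by case/andP => /andP [/negbTE -> _] /andP [-> _].
rewrite uy eqxx => exw; exists [:: u, x, w & s]; split.
- have Ux : uniq (x :: [:: u, w & s]).
    move: Uc xc; rewrite /= !inE !negb_or => /and4P [/and3P [_ -> ->] _ -> ->].
    by case/and4P=> -> _ -> ->.
  split.
  + by rewrite -(perm_uniq (s1 := x :: [:: u, w & s])) //;
      apply/permP => P /=; rewrite addnCA.
  + by rewrite /= e_sym exu exw.
  + by move: Hc; rewrite /= Hx => /and3P [-> _ ->].
  + by rewrite -ks.
- exact: mem_head.
- move: us; rewrite !inE !negb_or => /and3P [-> -> ->]; rewrite !andbT /=.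
  by apply: contraNneq xc => <-; rewrite !inE eqxx orbT.
- move=> z; rewrite !inE => /or4P [/eqP -> | /eqP -> | /eqP -> | zs];
    [right | by left | right | right];
    by apply: sub; rewrite !inE ?zs ?eqxx ?orbT.
Qed.

End Rerouting.

(** The new cycle skips [v]. From a triangle it is a single edge walked back and forth, of size
    2. *)
Lemma shortcut (T : finType) (e : rel T) (H : pred T) (d : seq T) v :
  symmetric e -> uniq d -> cycle e d -> all H d -> 2 < size d -> v \in d ->
  e (next d v) (prev d v) ->
  exists s, [/\ uniq s, cycle e s, all H s & (size s).+1 = size d].
Proof.
move=> e_sym Ud ed Hd d3 vd.
have [s [[{}Ud {}ed {}Hd sd] _ <- <-]] :=
  @kcycle_head _ e H (size d) d v (And4 Ud ed Hd erefl) vd.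
case: s sd Ud ed Hd => [|a s] sd; first by rewrite -sd in d3.
case/lastP: s sd => [|s b] sd; first by rewrite -sd in d3.
move=> Ud ed Hd.
have bN : b \notin v :: a :: s.
  by move: Ud; rewrite -rcons_cons -rcons_cons rcons_uniq => /andP [].
have nb : next [:: v, a & rcons s b] b = v.
  by rewrite -cats1 (@next_split _ v (a :: s) b).
have pv := prev_next Ud b; rewrite nb in pv.
rewrite pv /= eqxx => eab.
exists (a :: rcons s b); split; last exact: sd.
- by case/andP: Ud.
- move: ed; rewrite /= !rcons_path last_rcons => /and3P [_ -> _].
  by rewrite e_sym.
- by case/andP: Hd.
Qed.

(** * Gaps between cycle lengths *)

Section Gap.

Variables (T : finType) (e : rel T).
Hypotheses (e_sym : symmetric e) (e_irr : irreflexive e).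
Hypothesis deg6 : forall v, #|nbhd e v| <= 6.
Hypothesis link2 : forall v a b, e v a -> e v b -> a <> b -> e a b = false ->
  exists c, [/\ e v c, e c a & e c b].

Variables (z0 : T).
Let H : pred T := connect e z0.

Lemma component_closed a b : e a b -> H a -> H b.
Proof. by move=> eab; move/connect_trans; apply; exact: connect1. Qed.

(** The map [next d] sends the vertices of [d] outside [U] injectively to vertices of [d] in [U]. *)
Lemma independent_bound (d : seq T) (U : pred T) : uniq d -> cycle e d ->
  (forall a b, a \in d -> b \in d -> ~~ U a -> ~~ U b -> e a b = false) ->
  size d <= (count U d).*2.
Proof.
move=> Ud ed indep; rewrite -(count_predC U d) -addnn leq_add2l.
rewrite -!size_filter -(size_map (next d)).
apply: uniq_leq_size.
  by rewrite map_inj_uniq ?filter_uniq //; exact: can_inj (prev_next Ud).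
move=> z /mapP [y]; rewrite mem_filter => /andP [/= Uy yd] ->.
rewrite mem_filter mem_next yd andbT; apply/negPn/negP => Un.
by have := next_cycle ed yd; rewrite indep ?mem_next.
Qed.

Lemma no_gap (c d : seq T) :
  uniq c -> cycle e c -> all H c -> 2 < size c ->
  uniq d -> cycle e d -> all H d -> size c < (size d).-1 ->
  (forall s, cycle e s -> uniq s -> all H s -> size s <> (size c).+1) ->
  (forall s, cycle e s -> uniq s -> all H s -> size s <> (size d).-1) -> False.
Proof.
move=> Uc ec Hc c3 Ud ed Hd cd maximal minimal.
have kc : kcycle e H (size c) c by split.
have rig := kcycle_rigid e_sym e_irr component_closed maximal.
have rC := rig c kc c3.
have d3 : 2 < size d := leq_trans c3 (leq_trans (ltnW cd) (leq_pred _)).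
have cd' : ~~ (size d <= size c) by rewrite -ltnNge (leq_trans cd) ?leq_pred.
(* On a path starting in [c], a vertex off [c] that is adjacent to [c] can only be followed by a
   vertex of [c], by [off_nbhd]. *)
have near z : H z -> (z \in c) || [exists u, (u \in c) && e z u].
  move=> Hz.
  have [c0 c0c] : exists c0, c0 \in c.
    by case: (c) c3 => // c0 *; exists c0; exact: mem_head.
  have: connect e c0 z.
    apply: connect_trans Hz; rewrite (sym_connect_sym e_sym).
    exact: (allP Hc).
  case/connectP=> q + ->; elim/last_ind: q {z Hz} => [|q z IH].
    by rewrite c0c.
  rewrite rcons_path last_rcons => /andP [eq eqz].
  case qc: (last c0 q \in c).
    apply/orP; right; apply/existsP; exists (last c0 q).
    by rewrite qc e_sym.
  have := IH eq; rewrite qc => /existsP [u /andP [uc eu]].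
  apply/orP; left; exact: (off_nbhd e_sym e_irr deg6 link2 rC qc uc eu eqz).
(* Any cycle [c'] of the same length is allowed, since a cycle obtained from [c] by a swap is needed
   too. *)
have off_far a b c' : kcycle e H (size c) c' -> a \notin c' -> 
    (exists2 u, u \in c' & e a u) -> e a b -> b \in c'.
  move=> kc' /negbTE ac' [u uc' eau] eab.
  have rC' : rigid e (mem c') (next c') (prev c').
    by apply: rig => //; case: kc' => _ _ _ ->.
  exact: (off_nbhd e_sym e_irr deg6 link2 rC' ac' uc' eau eab).
case sub: (all (mem c) d).
  by apply: (negP cd'); apply: uniq_leq_size => //; exact/allP.
have [x xd xc] : exists2 x, x \in d & x \notin c by exact: (allPn (negbT sub)).
have Hx := allP Hd x xd.
have [v vc exv] : exists2 v, v \in c & e x v.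
  have := near x Hx; rewrite (negbTE xc) => /existsP [v /andP [vc exv]].
  by exists v.
have Cx : mem c x = false by exact: negbTE.
have Ux z : e x z -> z \in c by apply: off_far => //; exists v.
(* The neighbours of [x] on [d] are nonadjacent, or skipping [x] would give the excluded length;
   their link in N(x) is a third neighbour. *)
have third a b : exists z, [/\ e x z, z <> a & z <> b].
  have kd : kcycle e H (size d) d by split.
  have dnp := next_neq_prev kd d3 xd.
  have exn : e x (next d x) by exact: next_cycle.
  have exp : e x (prev d x) by rewrite e_sym; exact: prev_cycle.
  have enp : e (next d x) (prev d x) = false.
    apply/negP => /(shortcut e_sym Ud ed Hd d3 xd) [s [Us es Hs sd]].
    by apply: (minimal s); rewrite // -sd.
  have [m [exm emn emp]] := link2 exn exp dnp enp.
  have mn : m <> next d x by move=> E; rewrite E e_irr in emn.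
  have mp : m <> prev d x by move=> E; rewrite E e_irr in emp.
  case: (next d x =P a) => [<-|na].
    by case: (prev d x =P b) => [<-|pb]; [exists m | exists (prev d x)];
      split=> //; exact: nesym.
  case: (next d x =P b) => [<-|nb]; last by exists (next d x).
  by case: (prev d x =P a) => [<-|pa]; [exists m | exists (prev d x)];
    split=> //; exact: nesym.
have [alt_n alt_p] := star_alternating e_sym e_irr deg6 link2 Cx Ux third rC.
have altU z : z \in c -> ~~ e x z -> e x (prev c z) /\ e x (next c z).
  move=> zc exz.
  have : e x z || (e x (prev c z) && e x (next c z)).
    pose P z := e x z || (e x (prev c z) && e x (next c z)).
    apply: (rigid_ind rC (P := P) (u := v)) => //; first by rewrite /P exv.
    move=> y; rewrite /P => /orP [exy|/andP [-> ->]]; last by [].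
    rewrite prev_next // next_prev // exy alt_n // alt_p // !orbT; split=> //.
  by rewrite (negbTE exz) => /andP.
(* Replacing [a] by [x] on the cycle leaves [a] off it, so all neighbours of [a]
   are on the new cycle. *)
have mixed a b : a \in c -> ~~ e x a -> b \notin c -> e a b = false.
  move=> ac xa bc; apply/negP => eab; have [xp xn] := altU a ac xa.
  have pc : prev c a \in c by rewrite mem_prev.
  have na : next c (prev c a) = a by exact: next_prev.
  have [] := swap_kcycle e_sym component_closed kc c3 xc pc xp.
    by rewrite na.
  move=> c' [kc' uc' ac' c'c]; rewrite na in ac'.
  have bc' : b \in c'.
    apply: (off_far a) => //; exists (prev c a) => //.
    by rewrite e_sym; exact: prev_cycle.
  have [bx|bc''] := c'c b bc'; last by rewrite bc'' in bc.
  by rewrite -bx e_sym eab in xa.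
(* Two such vertices on [c] are successors of vertices of N(x), so [rigid2n] separates them; two off
   [c] are separated by [off_far]. *)
have indep a b : H a -> H b -> ~~ e x a -> ~~ e x b -> e a b = false.
  move=> Ha Hb xa xb; case ac: (a \in c); case bc: (b \in c).
  - have [xpa _] := altU a ac xa; have [xpb _] := altU b bc xb.
    case: (a =P b) => [->|ab]; first exact: e_irr.
    rewrite -(next_prev Uc a) -(next_prev Uc b).
    apply: (rigid2n rC Cx); rewrite /= ?mem_prev // => E.
    by apply: ab; rewrite -(next_prev Uc a) E next_prev.
  - by apply: mixed => //; rewrite bc.
  - by rewrite e_sym; apply: mixed => //; rewrite ac.
  - apply/negP => eab.
    have := near a Ha; rewrite ac => /existsP [u /andP [uc eau]].
    have bc' : b \in c by apply: (off_far a) => //; [rewrite ac | exists u].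
    by rewrite bc' in bc.
have dU : size d <= (count (e x) d).*2.
  apply: independent_bound => // a b ad bd; apply: indep; exact: (allP Hd).
have dcU : count (e x) d <= count (e x) c.
  rewrite -!size_filter; apply: uniq_leq_size; first exact: filter_uniq.
  by move=> z; rewrite !mem_filter => /andP [xz _]; rewrite xz Ux.
(* N(x) on [c] and its image under [next c] are disjoint. *)
have cU : (count (e x) c).*2 <= size c.
  rewrite -addnn -size_filter -[X in _ + X](size_map (next c)) -size_cat.
  apply: uniq_leq_size.
    rewrite cat_uniq filter_uniq // map_inj_uniq ?filter_uniq //; last first.
      exact: can_inj (prev_next Uc).
    rewrite andbT; apply/hasPn => z /mapP [y].
    rewrite !mem_filter => /andP [xy yc] ->.
    by rewrite (rigid1n rC Cx).
  move=> z; rewrite mem_cat => /orP [|/mapP [y]];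
    rewrite mem_filter => /andP [_ yc] //.
  by move=> ->; rewrite mem_next.
apply: (negP cd'); apply: leq_trans dU (leq_trans _ cU).
by rewrite leq_double.
Qed.

End Gap.

(** * From the absence of gaps to weak pancyclicity *)

Lemma bigmin_geq (I : finType) (P : pred I) (F : I -> nat) m n :
  m <= n -> (forall i, P i -> m <= F i) -> m <= \big[minn/n]_(i | P i) F i.
Proof.
move=> mn mF; elim/big_ind: _ => // a b ma mb; by rewrite leq_min ma mb.
Qed.

Theorem theorem3 (T : finType) (e : rel T)
    (e_sym : symmetric e) (e_irr : irreflexive e)
    (e_li : locally_isometric e)
    (Delta_le6 : max_degree e <= 6)
    (order_ge : max_degree e + 1 <= #|T|) :
  weakly_pancyclic e.
Proof.
have deg6 v : #|nbhd e v| <= 6.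
  by apply: leq_trans Delta_le6; exact: (leq_bigmax v).
have link2 v a b : e v a -> e v b -> a <> b -> e a b = false ->
    exists c, [/\ e v c, e c a & e c b].
  move=> eva evb ab eab.
  have ia : a \in nbhd e v by rewrite inE.
  have ib : b \in nbhd e v by rewrite inE.
  have [[|c [|? []]] []] := e_li v (Sub a ia) (Sub b ib).
  - by move=> _ [].
  - by rewrite /induced /= andbT => + E; rewrite E /= eab.
  - move=> /= /and3P [ec eb _] E _; exists (val c).
    rewrite E /induced /= in ec eb *.
    split; [by have := valP c; rewrite inE | by rewrite e_sym | exact: eb].
  - by move=> ? ? ? [].
move=> k /andP [gk kc].
(* Lengths are recorded within one component, because [no_gap] compares cycles of the same
   component. *)
pose hasH z0 j := [exists p : j.-tuple T, ucycleb e p && all (connect e z0) p].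
have hasP z0 j : reflect
    (exists s, [/\ uniq s, cycle e s, all (connect e z0) s & size s = j])
    (hasH z0 j).
  apply: (iffP existsP) => [[p /andP [/andP [ep Up] Hp]]|[s [Us es Hs sj]]].
    by exists p; rewrite size_tuple.
  have sj' : size s == j by apply/eqP.
  by exists (Tuple sj'); rewrite /ucycleb /= es Us Hs.
have [k3 [d [Ud ed d3 kd]]] : 2 < k /\
    exists d, [/\ uniq d, cycle e d, 2 < size d & k <= size d].
  case: (pickP (fun i : 'I_#|T|.+1 => has_cycle e i)) => [i ci|none].
    have [i3 _] := andP ci; split.
      apply: leq_trans gk; apply: bigmin_geq => [|j /andP []] //.
      exact: leq_trans i3 (ltnW (ltn_ord i)).
    have [j + circ] := @eq_bigmax_cond _ (fun i : 'I_#|T|.+1 => has_cycle e i)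
      (@nat_of_ord _) (introT card_gt0P (ex_intro _ i ci)).
    case/andP=> j3 /existsP [s /andP [es Us]].
    by exists s; rewrite size_tuple; split=> //; rewrite -circ.
  move: gk kc; rewrite /girth /circumference !big_pred0 //.
  by move=> /leq_trans lt /lt.
have [z0 Hd] : exists z0, all (connect e z0) d.
  case: (d) ed d3 => // z s es _; exists z; apply/allP => y ys.
  apply: path_connect es _ _; move: ys.
  by rewrite !inE mem_rcons inE; case: (y == z).
suff: hasH z0 k.
  case/hasP => s [Us es _ sk]; rewrite /has_cycle k3 /=; apply/existsP.
  have sk' : size s == k by apply/eqP.
  by exists (Tuple sk'); rewrite /ucycleb /= es Us.
(* The two neighbours of [v] on [d] are adjacent, or a link between them in N(v) forms a triangle
   with [v] and one of them. *)
have triangle : hasH z0 3.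
  have [v vd] : exists v, v \in d.
    by case: (d) d3 => // v *; exists v; exact: mem_head.
  have kd' : kcycle e (connect e z0) (size d) d by split.
  have dnp := next_neq_prev kd' d3 vd.
  have evn : e v (next d v) by exact: next_cycle.
  have evp : e v (prev d v) by rewrite e_sym; exact: prev_cycle.
  have tri a b : e v a -> e v b -> e a b -> hasH z0 3.
    move=> eva evb eab; apply/hasP; exists [:: v; a; b].
    have Hv := allP Hd v vd; split=> //=.
    - rewrite !inE negb_or !andbT; apply/andP; split; last first.
        by apply: contraTneq eab => ->; rewrite e_irr.
      by apply/andP; split; [apply: contraTneq eva | apply: contraTneq evb];
        move=> <-; rewrite e_irr.
    - by rewrite eva eab e_sym evb.
    - by rewrite Hv !(component_closed _ Hv).
  case enp: (e (next d v) (prev d v)); first exact: (tri (next d v) (prev d v)).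
  have [c [evc ecn _]] := link2 v _ _ evn evp dnp enp.
  exact: (tri c (next d v)).
have hd : hasH z0 (size d) by apply/hasP; exists d.
suff: k - 3 + 3 <= size d -> hasH z0 (k - 3 + 3) by rewrite subnK //; apply.
elim: (k - 3) => [|j IH] // jd.
have {}IH := IH (ltnW jd); case nj: (hasH z0 _) => //; exfalso.
(* Take the least length [m] of a cycle beyond the missing length [j.+1 + 3]. Then [m.-1] is missing
   as well, by minimality or because it equals [j.+1 + 3]. *)
have ex : exists l, hasH z0 l && (j.+1 + 3 < l).
  exists (size d); rewrite hd ltn_neqAle jd andbT.
  by apply: contraFneq nj => ->.
case: (ex_minnP ex) => m /andP [/hasP [d' [Ud' ed' Hd' sd']] jm] minm.
case/hasP: IH => c [Uc ec Hc sc].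
apply: (@no_gap _ e e_sym e_irr deg6 link2 z0 c d') => //.
- by rewrite sc addn3.
- by rewrite sc sd'; move: jm; case: (m) => // m' ; rewrite addSn ltnS.
- move=> s es Us Hs ss; move/hasP: nj; apply.
  by exists s; rewrite ss sc.
- move=> s es Us Hs ss.
  have hs : hasH z0 m.-1 by apply/hasP; exists s; rewrite ss sd'.
  case: (ltnP (j.+1 + 3) m.-1) => [lt|le].
    have := minm m.-1; rewrite hs lt => /(_ isT).
    by move: jm; case: (m) => // m' _; rewrite ltnn.
  have mj : m.-1 = j.+1 + 3.
    by apply/eqP; rewrite eqn_leq le; move: jm; case: (m).
  by rewrite -mj hs in nj.
Qed.
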